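(* Let $R$ be a left cotorsion ring. Then $R$ is right strongly exchange.
   Context: Rings are associative with identity. A ring $R$ is left cotorsion if $\operatorname{Ext}^1_R(F,R)=0$ for every flat left $R$-module $F$ (with $R$ regarded as a left module over itself). A right coprime pair in $R$ is a pair of elements $a,b\in R$ with $aR+bR=R$. Two right coprime pairs $(a,b)$, $(a',b')$ are identified when $aR=a'R$ and $bR=b'R$; $\langle a,b\rangle$ denotes the equivalence class, $\mathrm{RCP}(R)$ the set of all classes, and a pair $(a',b')$ with $\langle a',b'\rangle=\langle a,b\rangle$ is called a pair of generators of $\langle a,b\rangle$. $\mathrm{RCP}(R)$ is partially ordered by $\langle a,b\rangle\le\langle a',b'\rangle$ iff $aR\subseteq a'R$ and $bR\subseteq b'R$. A compatible descending chain of right coprime pairs is a family $\{p_\alpha\mid\alpha<\kappa\}\subseteq \mathrm{RCP}(R)$ ($\kappa$ an ordinal, $p_\beta\le p_\alpha$ for $\alpha<\beta<\kappa$) such that there exist a pair of generators $(a_\alpha,b_\alpha)$ of $p_\alpha$ for each $\alpha<\kappa$, and elements $r_{\alpha\beta},s_{\alpha\beta}\in R$ for $\alpha<\beta<\kappa$, with $a_\beta=a_\alpha r_{\alpha\beta}$ and $b_\beta=b_\alpha s_{\alpha\beta}$ for all $\alpha<\beta<\kappa$, and $r_{\alpha\beta}=r_{\alpha\gamma}r_{\gamma\beta}$, $s_{\alpha\beta}=s_{\alpha\gamma}s_{\gamma\beta}$ for all $\alpha<\gamma<\beta<\kappa$. A minimal lower bound of a chain is a lower bound of the chain in $\mathrm{RCP}(R)$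 that is a minimal element of the poset $\mathrm{RCP}(R)$. The ring $R$ is right strongly exchange if every compatible descending chain of right coprime pairs of $R$ has a minimal lower bound. *)

(* Defs.v *)
From HB Require Import structures.
From mathcomp Require Import all_boot all_order all_algebra ring_quotient.
From mathcomp Require Import boolp classical_sets wochoice.
From mathcomp.multinomials Require Import freeg.

Set Implicit Arguments.
Unset Strict Implicit.
Unset Printing Implicit Defensive.

Import Order.TTheory GRing.Theory.

Local Open Scope ring_scope.
Local Open Scope classical_set_scope.
Local Open Scope quotient_scope.

(* A right R-module is an [lmodType R^c]; [(r : R^c) *: m] stands for m r. *)

Section Tensor.
Variables (R : pzRingType) (M : lmodType R^c) (F : lmodType R).

Local Notation word m x := (<< (m, x) >> : {freeg (M * F)%type / int}).

Definition tensor_relators : set {freeg (M * F)%type / int} :=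
  [set z | [\/ exists m m' x, z = word (m + m') x - word m x - word m' x,
               exists m x x', z = word m (x + x') - word m x - word m x' |
               exists m (r : R) x, z = word ((r : R^c) *: m) x - word m (r *: x)]].

(* the subgroup of the free abelian group generated by the relators *)
Definition tensor_null : {pred {freeg (M * F)%type / int}} :=
  fun z => `[< forall S : {pred {freeg (M * F)%type / int}}, zmod_closed S ->
               (forall y, tensor_relators y -> y \in S) -> z \in S >].

Lemma tensor_nullP z : z \in tensor_null <->
  forall S : {pred {freeg (M * F)%type / int}}, zmod_closed S ->
    (forall y, tensor_relators y -> y \in S) -> z \in S.
Proof. by split=> [/asboolP|h]; last exact/asboolP. Qed.

Lemma tensor_null_zmod_closed : zmod_closed tensor_null.
Proof.
split=> [|y z /tensor_nullP hy /tensor_nullP hz]; apply/tensor_nullP => S hS sub.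
  by case: hS.
by case: (hS) => _; apply; [exact: hy | exact: hz].
Qed.

HB.instance Definition _ :=
  GRing.isZmodClosed.Build {freeg (M * F)%type / int} tensor_null
    tensor_null_zmod_closed.

Definition tensor : zmodType := Quotient.quot tensor_null.

Definition tens (m : M) (x : F) : tensor :=
  \pi_(Quotient.quot tensor_null) (word m x).

Lemma pi_tensorB z t : \pi_(Quotient.quot tensor_null) (z - t) =
  (\pi_(Quotient.quot tensor_null) z : tensor) - \pi_(Quotient.quot tensor_null) t.
Proof. by rewrite !piE. Qed.

Section Lift.
Variables (A : zmodType) (phi : M -> F -> A).

Definition balanced :=
  [/\ forall x, {morph phi^~ x : m m' / m + m'},
      forall m, {morph phi m : x x' / x + x'} &
      forall m (r : R) x, phi ((r : R^c) *: m) x = phi m (r *: x)].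

Definition word_lift (z : {freeg (M * F)%type / int}) : A :=
  fglift ((fun mx => phi mx.1 mx.2) : M * F -> ssrint.zmodule A) z.

Definition tensor_lift (t : tensor) : A := word_lift (repr t).

Lemma word_liftB : {morph word_lift : z t / z - t}.
Proof. by move=> z t; exact: (@lift_is_additive _ _ (ssrint.zmodule A)). Qed.

Lemma word_liftE m x : word_lift (word m x) = phi m x.
Proof. by rewrite /word_lift liftU scale1r. Qed.

Lemma word_lift_null z : balanced -> z \in tensor_null -> word_lift z = 0.
Proof.
move=> [phiDl phiDr phiZ] /tensor_nullP hz; apply/eqP.
apply: (hz [pred z | word_lift z == 0]) => [|y].
  split=> [|y t]; rewrite !inE; first by have := word_liftB 0 0; rewrite !subrr => ->.
  by move=> /eqP hy /eqP ht; rewrite word_liftB hy ht subrr.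
rewrite inE => -[] [m [m' [x ->]]]; rewrite !word_liftB !word_liftE.
- by rewrite phiDl addrAC addrK subrr.
- by rewrite phiDr addrAC addrK subrr.
- by rewrite phiZ subrr.
Qed.

Lemma tensor_lift_pi z : balanced ->
  tensor_lift (\pi_(Quotient.quot tensor_null) z) = word_lift z.
Proof.
move=> phib; apply/eqP; rewrite -subr_eq0 -word_liftB; apply/eqP.
by apply: word_lift_null => //; rewrite Quotient.idealrBE reprK.
Qed.

Lemma tensor_liftE m x : balanced -> tensor_lift (tens m x) = phi m x.
Proof. by move=> phib; rewrite tensor_lift_pi // word_liftE. Qed.

Lemma tensor_liftB : balanced -> {morph tensor_lift : t u / t - u}.
Proof.
move=> phib t u; rewrite -[t]reprK -[u]reprK -pi_tensorB !tensor_lift_pi //.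
exact: word_liftB.
Qed.

End Lift.

Lemma tens_balanced : balanced tens.
Proof.
have null0 z : tensor_relators z -> z \in tensor_null.
  by move=> hz; apply/tensor_nullP => S _; apply.
have eqpi z t : tensor_relators (z - t) ->
  \pi_(Quotient.quot tensor_null) z = \pi_(Quotient.quot tensor_null) t :> tensor.
  by move=> /null0 h; apply/eqP; rewrite -Quotient.idealrBE.
have piD z t : \pi_(Quotient.quot tensor_null) (z + t) =
  (\pi_(Quotient.quot tensor_null) z : tensor) + \pi_(Quotient.quot tensor_null) t.
  by rewrite !piE.
split=> [x m m'|m x x'|m r x]; rewrite /tens -?piD; apply: eqpi.
- by rewrite opprD addrA; apply: Or31; exists m, m', x.
- by rewrite opprD addrA; apply: Or32; exists m, x, x'.
- by apply: Or33; exists m, r, x.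
Qed.

End Tensor.

Definition tensor_map (R : pzRingType) (M N : lmodType R^c) (F : lmodType R)
    (f : {linear M -> N}) : tensor M F -> tensor N F :=
  tensor_lift (fun m x => tens (f m) x).

Lemma tensor_mapE (R : pzRingType) (M N : lmodType R^c) (F : lmodType R)
    (f : {linear M -> N}) (m : M) (x : F) :
  tensor_map f (tens m x) = tens (f m) x.
Proof.
have [tDl tDr tZ] := tens_balanced N F.
apply: tensor_liftE; split=> [y a b|a|a r y] /=; first by rewrite linearD tDl.
  exact: tDr.
by rewrite linearZ tZ.
Qed.

Lemma tensor_mapB (R : pzRingType) (M N : lmodType R^c) (F : lmodType R)
    (f : {linear M -> N}) :
  {morph tensor_map (F := F) f : t u / t - u}.
Proof.
have [tDl tDr tZ] := tens_balanced N F.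
apply: tensor_liftB; split=> [y a b|a|a r y] /=; first by rewrite linearD tDl.
  exact: tDr.
by rewrite linearZ tZ.
Qed.

Definition flat (R : pzRingType) (F : lmodType R) : Prop :=
  forall (M N : lmodType R^c) (f : {linear M -> N}),
    injective f -> injective (tensor_map (F := F) f).

Definition projective (R : pzRingType) (P : lmodType R) : Prop :=
  forall (A B : lmodType R) (p : {linear A -> B}) (f : {linear P -> B}),
    (forall b, exists a, p a = b) -> exists g : {linear P -> A}, p \o g =1 f.

Record projective_resolution (R : pzRingType) (F : lmodType R) := {
  res_obj :> nat -> lmodType R;
  res_diff : forall n, {linear res_obj n.+1 -> res_obj n};
  res_aug : {linear res_obj 0 -> F};
  res_projective : forall n, projective (res_obj n);
  res_aug_surj : forall y, exists x, res_aug x = y;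
  res_exact0 : forall x, res_aug x = 0 <-> exists y, res_diff 0 y = x;
  res_exact : forall n x, res_diff n x = 0 <-> exists y, res_diff n.+1 y = x
}.

(* Ext^(n+1)_R(F, M) = 0: for every projective resolution P of F, the complex
   Hom_R(P, M) is exact in degree n + 1. *)
Definition ExtS_eq0 (R : pzRingType) (n : nat) (F M : lmodType R) : Prop :=
  forall (P : projective_resolution F) (f : {linear P n.+1 -> M}),
    (forall x, f (res_diff P n.+1 x) = 0) ->
    exists g : {linear P n -> M}, forall x, g (res_diff P n x) = f x.

Definition left_cotorsion (R : pzRingType) : Prop :=
  forall F : lmodType R, flat F -> ExtS_eq0 0 F R^o.

Section RightCoprimePairs.
Variable R : pzRingType.
Implicit Types (a b : R).

Definition right_ideal a : set R := range ( *%R a).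

Definition right_coprime (ab : R * R) : Prop :=
  [set x + y | x in right_ideal ab.1 & y in right_ideal ab.2] = setT.

Record coprime_pair := CoprimePair {
  coprime_pair_val :> R * R;
  coprime_pairP : `[< right_coprime coprime_pair_val >]
}.

HB.instance Definition _ := [isSub for coprime_pair_val].
HB.instance Definition _ := [Choice of coprime_pair by <:].
Implicit Types p q : coprime_pair.

Definition coprime_pair_equiv p q : bool :=
  `[< right_ideal p.1 = right_ideal q.1 /\ right_ideal p.2 = right_ideal q.2 >].

Lemma coprime_pair_equiv_class : equiv_class_of coprime_pair_equiv.
Proof.
split=> [p|p q|q p r]; first exact/asboolP.
  by apply/asboolP/asboolP => -[-> ->].
by move=> /asboolP[e1 e2] /asboolP[e3 e4]; apply/asboolP; split; [rewrite -e3|rewrite -e4].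
Qed.

Canonical coprime_pair_equiv_equiv := EquivRelPack coprime_pair_equiv_class.

Definition RCP := {eq_quot coprime_pair_equiv}.
HB.instance Definition _ := Choice.on RCP.
HB.instance Definition _ : EqQuotient coprime_pair coprime_pair_equiv RCP :=
  EqQuotient.on RCP.

Definition coprime_pair_le p q : bool :=
  `[< right_ideal p.1 `<=` right_ideal q.1 /\
      right_ideal p.2 `<=` right_ideal q.2 >].

Definition RCP_le : rel RCP := fun P Q => coprime_pair_le (repr P) (repr Q).

Lemma RCP_le_pi p q : RCP_le (\pi_RCP p) (\pi_RCP q) = coprime_pair_le p q.
Proof.
rewrite /RCP_le /coprime_pair_le.
have h s : right_ideal (repr (\pi_RCP s)).1 = right_ideal s.1 /\
           right_ideal (repr (\pi_RCP s)).2 = right_ideal s.2.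
  by apply/asboolP; rewrite -/(coprime_pair_equiv _ _) -eqmodE reprK.
by case: (h p) (h q) => -> -> [-> ->].
Qed.

Lemma RCP_le_refl : reflexive RCP_le.
Proof. by move=> P; apply/asboolP; split; exact: subset_refl. Qed.

Lemma RCP_le_anti : antisymmetric RCP_le.
Proof.
move=> P Q /andP[/asboolP[h1 h2] /asboolP[h3 h4]].
rewrite -[P]reprK -[Q]reprK; apply/eqP; rewrite eqmodE; apply/asboolP.
by split; rewrite eqEsubset.
Qed.

Lemma RCP_le_trans : transitive RCP_le.
Proof.
move=> Q P S /asboolP[h1 h2] /asboolP[h3 h4]; apply/asboolP; split.
  exact: subset_trans h3.
exact: subset_trans h4.
Qed.

Fact RCP_display : Order.disp_t. Proof. exact: Order.Disp tt tt. Qed.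
HB.instance Definition _ := Order.Le_isPOrder.Build RCP_display RCP
  RCP_le_refl RCP_le_anti RCP_le_trans.

Definition generators (P : RCP) (ab : R * R) : Prop :=
  exists p : coprime_pair, p = ab :> R * R /\ \pi_RCP p = P.

(* An ordinal-indexed family is one indexed by a well-ordered type I. *)
Definition compatible_descending_chain d (I : orderType d) (P : I -> RCP) : Prop :=
  (forall i j : I, (i < j)%O -> (P j <= P i)%O) /\
  exists (a b : I -> R) (r s : I -> I -> R),
  [/\ forall i, generators (P i) (a i, b i),
      forall i j : I, (i < j)%O -> a j = a i * r i j /\ b j = b i * s i j &
      forall i k j : I, (i < k)%O -> (k < j)%O ->
        r i j = r i k * r k j /\ s i j = s i k * s k j].

Definition minimal_lower_bound d (I : orderType d) (P : I -> RCP) (Q : RCP) : Prop :=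
  (forall i, (Q <= P i)%O) /\ minimal (<=%O : rel RCP) Q.

Definition right_strongly_exchange : Prop :=
  forall d (I : orderType d), well_order (<=%O : rel I) ->
  forall P : I -> RCP, compatible_descending_chain P ->
  exists Q : RCP, minimal_lower_bound P Q.

End RightCoprimePairs.

(* Main.v *)
(* Along a compatible chain (a_i, b_i), with transitions r_ij and s_ij, the maps
   R -> R^2, z |-> (z a_i, z b_i), are split monomorphisms of left modules. They
   form a directed system whose transition maps are the right multiplications by
   (r_ij, s_ij), so the cokernel C of their direct limit is flat. If P is the
   free module on generators e_i, f_i mapping onto C, then an element of
   the kernel K of P -> C becomes z (a_k, b_k) at all large stages k, for a
   unique z. Since Ext^1(C, R) = 0, the map K -> R so defined extends to
   g : P -> R. As e_i - r_ij e_j goes to 0 and a_i e_i + b_i f_i goes to 1, the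
   elements rho_i = g e_i and sigma_i = g f_i satisfy rho_i = r_ij rho_j,
   sigma_i = s_ij sigma_j and a_i rho_i + b_i sigma_i = 1: every nonempty
   compatible chain has a lower bound (a_i rho_i, b_i sigma_i) to which the
   transitions extend compatibly. Applied to a compatible chain that is maximal
   among those below a given coprime pair, this yields a minimal pair below the
   given one. *)
From HB Require Import structures.
Require Import Defs.
From mathcomp Require Import all_boot all_order all_algebra ring_quotient.
From mathcomp Require Import finmap boolp classical_sets functions cardinality.
From mathcomp Require Import fsbigop.
From mathcomp.multinomials Require Import freeg.

Set Implicit Arguments.
Unset Strict Implicit.
Unset Printing Implicit Defensive.

Import Order.TTheory GRing.Theory.

Local Open Scope ring_scope.
Local Open Scope classical_set_scope.
Local Open Scope quotient_scope.

(** * Free modules as finitely supported functions *)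

Section FreeModule.
Variables (R : pzRingType) (X : choiceType).

(** Finite support cuts out a submodule of the functions [X -> R^o], so the free module inherits its
    module structure pointwise. *)
Definition finsupp : {pred X -> R^o} :=
  fun f => `[< finite_set [set x | f x != 0] >].

Lemma finsupp_submod_closed : submod_closed finsupp.
Proof.
split=> [|c f g /asboolP hf /asboolP hg]; apply/asboolP.
  by apply: (sub_finite_set (B := set0)) => // x /=; rewrite eqxx.
apply: (@sub_finite_set _ _ ([set x | f x != 0] `|` [set x | g x != 0])).
  move=> x /=; case: (eqVneq (f x) 0) => [fx0|]; last by left.
  by rewrite addrfctE scalrfctE fx0 scaler0 add0r; right.
by rewrite finite_setU.
Qed.

HB.instance Definition _ :=
  GRing.isSubmodClosed.Build R (X -> R^o) finsupp finsupp_submod_closed.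

Record freemod := Freemod { free_val : X -> R^o; _ : free_val \in finsupp }.

HB.instance Definition _ := [isSub for free_val].
HB.instance Definition _ := [Choice of freemod by <:].
HB.instance Definition _ := [SubChoice_isSubLmodule of freemod by <:].

Lemma free_delta_subproof x : (fun y => (y == x)%:R : R^o) \in finsupp.
Proof.
apply/asboolP; apply: (sub_finite_set (B := [set x])) => // y /=.
by case: (eqVneq y x) => //= _; rewrite eqxx.
Qed.

Definition free_delta x : freemod := Freemod (free_delta_subproof x).

Definition coef (p : freemod) x : R := val p x.

Lemma coefP c p q x : coef (c *: p + q) x = c * coef p x + coef q x.
Proof. by rewrite /coef linearP addrfctE scalrfctE. Qed.

Lemma coef_delta x y : coef (free_delta x) y = (y == x)%:R.
Proof. by []. Qed.

Lemma free_finite (p : freemod) : finite_set [set x | coef p x != 0].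
Proof. by apply/asboolP; case: p. Qed.

Section Lift.
Variables (M : lmodType R) (g : X -> M).

Definition free_lift (p : freemod) : M := \sum_(x \in [set: X]) coef p x *: g x.

(** Two elements with different supports can thus be summed over one common finite set, as linearity
    requires. *)
Lemma free_liftE (A : set X) (p : freemod) : [set x | coef p x != 0] `<=` A ->
  free_lift p = \sum_(x \in A) coef p x *: g x.
Proof.
move=> pA; apply/esym/fsbig_widen => // x [_ /= nAx].
by case: (eqVneq (coef p x) 0) => [->|/pA//]; rewrite scale0r.
Qed.

Lemma free_lift_is_linear : linear free_lift.
Proof.
move=> c p q; pose A := [set x | coef p x != 0] `|` [set x | coef q x != 0].
have Afin : finite_set A by rewrite finite_setU; split; exact: free_finite.
rewrite (@free_liftE A p) ?(@free_liftE A q); [|by right|by left].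
rewrite (@free_liftE A) => [|x /=]; last first.
  rewrite coefP; case: (eqVneq (coef p x) 0) => [->|]; last by left.
  by rewrite mulr0 add0r; right.
rewrite !fsbig_finite// scaler_sumr -big_split; apply: eq_bigr => x _ /=.
by rewrite coefP scalerDl scalerA.
Qed.

HB.instance Definition _ :=
  GRing.isLinear.Build R freemod M _ free_lift free_lift_is_linear.

Lemma free_lift_delta x : free_lift (free_delta x) = g x.
Proof.
rewrite (@free_liftE [set x]) => [|y /=]; last first.
  by rewrite coef_delta; case: (eqVneq y x) => //= _; rewrite eqxx.
by rewrite fsbig_set1 coef_delta eqxx scale1r.
Qed.

End Lift.

(** Every element is the finite combination of basis elements weighted by its coefficients; this is
    checked coefficient by coefficient. *)
Lemma free_ind (S : {pred freemod}) : submod_closed S ->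
  (forall x, free_delta x \in S) -> forall p, p \in S.
Proof.
move=> [S0 SP] Sdelta p.
suff -> : p = free_lift free_delta p.
  rewrite /free_lift; elim/big_ind: _ => // [q r Sq Sr|x _].
    by rewrite -[q]scale1r SP.
  by rewrite -[_ *: _]addr0 SP.
apply/val_inj/funext => y.
rewrite (free_liftE _ (@subset_refl _ _)) fsbig_finite; last exact: free_finite.
have coef_sum s (F : X -> freemod) :
    coef (\sum_(x <- s) F x) y = \sum_(x <- s) coef (F x) y.
  by rewrite /coef linear_sum fct_sumE.
have coefZ c q : coef (c *: q) y = c * coef q y.
  by rewrite -[c *: q]addr0 coefP /coef linear0 addr0.
rewrite -[LHS]/(coef p y) -[RHS]/(coef _ y) coef_sum.
under eq_bigr do rewrite coefZ coef_delta.
have [py0|py0] := eqVneq (coef p y) 0.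
  rewrite py0 big1_seq// => x; rewrite in_fset_set ?inE;
    last exact: free_finite.
  by case: (eqVneq y x) => [<-|_ _]; rewrite ?py0 ?mul0r ?mulr0.
rewrite (bigD1_seq y) /=; last exact: fset_uniq.
  by rewrite eqxx mulr1 big1 ?addr0 => // x /negPf yx; rewrite eq_sym yx mulr0.
by rewrite in_fset_set ?inE //; exact: free_finite.
Qed.

Lemma free_eq_linear (M : lmodType R) (f g : {linear freemod -> M}) :
  (forall x, f (free_delta x) = g (free_delta x)) -> f =1 g.
Proof.
move=> fg p; apply/eqP.
apply: (@free_ind [pred p | f p == g p]) => [|x]; last by rewrite inE fg.
split=> [|c q q']; rewrite !inE ?linear0// => /eqP e /eqP e'.
by rewrite !linearP e e'.
Qed.

Lemma free_projective : projective freemod.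
Proof.
move=> A B p f psurj; have [h hE] := choice (fun x => psurj (f (free_delta x))).
exists (free_lift h); apply: (@free_eq_linear _ (p \o free_lift h)) => x /=.
by rewrite free_lift_delta.
Qed.

End FreeModule.

(** * Kernels of linear maps and their free covers *)

Section Kernel.
Variables (R : pzRingType) (A B : lmodType R) (p : {linear A -> B}).

Definition kerp : {pred A} := [pred x | p x == 0].

Lemma kerp_submod_closed : submod_closed kerp.
Proof.
split=> [|c x y]; rewrite !inE ?linear0// => /eqP px /eqP py.
by rewrite linearP px py scaler0 addr0.
Qed.

HB.instance Definition _ :=
  GRing.isSubmodClosed.Build R A kerp kerp_submod_closed.

Record ker := Ker { ker_val : A; _ : ker_val \in kerp }.

HB.instance Definition _ := [isSub for ker_val].
HB.instance Definition _ := [Choice of ker by <:].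
HB.instance Definition _ := [SubChoice_isSubLmodule of ker by <:].

Lemma ker_valP (x : ker) : p (val x) = 0.
Proof. by case: x => x /= /eqP. Qed.

End Kernel.

Section Cover.
Variables (R : pzRingType) (A B : lmodType R) (p : {linear A -> B}).

(** All elements of the kernel serve as generators, so no generating set has to be chosen. *)
Definition ker_cover : {linear freemod R (ker p) -> A} :=
  (val : {linear ker p -> A}) \o
  (free_lift id : {linear freemod R (ker p) -> ker p}).

Lemma ker_coverP x : p x = 0 <-> exists y, ker_cover y = x.
Proof.
split=> [px|[y <-]]; last exact: ker_valP.
have kx : x \in kerp p by apply/eqP.
by exists (free_delta R (Ker kx)); rewrite /= free_lift_delta.
Qed.

End Cover.

(** * Free resolutions, and extension of maps when Ext vanishes *)

Section Resolution.
Variables (R : pzRingType) (F P : lmodType R) (p : {linear P -> F}).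

(** Source and target are bundled with the map because both change at each step of the recursion
    [syzygy]. *)
Record arrow := Arrow {
  arrow_src : lmodType R; arrow_tgt : lmodType R;
  arrow_fun : {linear arrow_src -> arrow_tgt} }.

Fixpoint syzygy n : arrow :=
  if n is m.+1 then Arrow (ker_cover (arrow_fun (syzygy m))) else Arrow p.

Hypotheses (Pproj : projective P) (psurj : forall y, exists x, p x = y).

(** Starts at [P] itself and covers successive kernels. It is transparent so that its terms and
    differentials reduce to those of [syzygy]. *)
Definition free_resolution : projective_resolution F.
Proof.
apply: (@Build_projective_resolution R F (fun n => arrow_src (syzygy n))
  (fun n => arrow_fun (syzygy n.+1)) p).
- by case=> //= n; exact: free_projective.
- exact: psurj.
- exact: (ker_coverP p).
- by move=> n; exact: (ker_coverP (arrow_fun (syzygy n.+1))).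
Defined.

(** Composed with the cover of the kernel of [p], [f] becomes a 1-cocycle of the resolution; a
    cochain bounding it is the extension. Outside the kernel [f] may be arbitrary. *)
Lemma ext_extend (M : lmodType R) (f : P -> M) : ExtS_eq0 0 F M ->
  (forall c x y, p x = 0 -> p y = 0 -> f (c *: x + y) = c *: f x + f y) ->
  exists g : {linear P -> M}, forall x, p x = 0 -> g x = f x.
Proof.
move=> ext0 flin.
have pk x : p (ker_cover p x) = 0 by apply/ker_coverP; exists x.
have fk_linear : linear (f \o ker_cover p).
  by move=> c x y; rewrite -(flin c _ _ (pk x) (pk y)) -linearP.
pose fk := HB.pack_for {linear freemod R (ker p) -> M} (f \o ker_cover p)
  (GRing.isLinear.Build R (freemod R (ker p)) M _ (f \o ker_cover p) fk_linear).
have f0 : f 0 = 0.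
  have := flin (-1) 0 0 (linear0 p) (linear0 p).
  by rewrite scaler0 add0r scaleN1r addNr.
have [|g gE] := ext0 free_resolution fk.
  move=> x; suff kx : ker_cover p (ker_cover (ker_cover p) x) = 0.
    by rewrite -f0 -kx.
  by apply: (ker_coverP (ker_cover p) _).2; exists x.
by exists g => x /ker_coverP[y <-]; exact: gE.
Qed.

End Resolution.

(** * Quotient modules *)

Section QuotientModule.
Variables (R : pzRingType) (P : lmodType R) (K : {pred P}).
Hypothesis (Kclosed : submod_closed K).

(* a copy of [K] whose head constant carries the closure instances *)
Definition submod of submod_closed K : {pred P} := K.
HB.instance Definition _ :=
  GRing.isSubmodClosed.Build R P (submod Kclosed) Kclosed.

Definition lmod_quot : Type := Quotient.quot (submod Kclosed).
HB.instance Definition _ := GRing.Zmodule.on lmod_quot.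

Definition lmod_pi (x : P) : lmod_quot :=
  \pi_(Quotient.quot (submod Kclosed)) x.
Definition lmod_repr (x : lmod_quot) : P :=
  repr (x : Quotient.quot (submod Kclosed)).

Lemma lmod_piD : {morph lmod_pi : x y / x + y}.
Proof. by move=> x y; rewrite /lmod_pi !piE. Qed.

Lemma lmod_reprK : cancel lmod_repr lmod_pi.
Proof. exact: reprK. Qed.

Lemma lmod_pi_eq x y : lmod_pi x = lmod_pi y <-> x - y \in K.
Proof. by rewrite -[K]/(submod Kclosed) Quotient.idealrBE; split=> /eqP. Qed.

(** Scalars act through chosen representatives; independence of the choice is [lmod_scale_pi]. *)
Definition lmod_scale c (x : lmod_quot) := lmod_pi (c *: lmod_repr x).

Lemma lmod_scale_pi c x : lmod_scale c (lmod_pi x) = lmod_pi (c *: x).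
Proof.
apply/lmod_pi_eq.
rewrite -[K]/(submod Kclosed) -scalerBr rpredZ //; apply/lmod_pi_eq/lmod_reprK.
Qed.

Lemma lmod_scaleA c d x : lmod_scale c (lmod_scale d x) = lmod_scale (c * d) x.
Proof. by rewrite -[x]lmod_reprK !lmod_scale_pi scalerA. Qed.

Lemma lmod_scale1 : left_id 1 lmod_scale.
Proof. by move=> x; rewrite -[x]lmod_reprK lmod_scale_pi scale1r. Qed.

Lemma lmod_scaleDr : right_distributive lmod_scale +%R.
Proof.
move=> c x y; rewrite -[x]lmod_reprK -[y]lmod_reprK.
by rewrite -lmod_piD !lmod_scale_pi scalerDr lmod_piD.
Qed.

Lemma lmod_scaleDl x : {morph lmod_scale^~ x : c d / c + d}.
Proof.
by move=> c d; rewrite -[x]lmod_reprK !lmod_scale_pi scalerDl lmod_piD.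
Qed.

HB.instance Definition _ := GRing.Zmodule_isLmodule.Build R lmod_quot
  lmod_scaleA lmod_scale1 lmod_scaleDr lmod_scaleDl.

Lemma lmod_pi_is_linear : linear lmod_pi.
Proof. by move=> c x y; rewrite lmod_piD -lmod_scale_pi. Qed.

HB.instance Definition _ :=
  GRing.isLinear.Build R P lmod_quot _ lmod_pi lmod_pi_is_linear.

Lemma lmod_pi_eq0 x : lmod_pi x = 0 <-> x \in K.
Proof. by rewrite -(linear0 lmod_pi) lmod_pi_eq subr0. Qed.

End QuotientModule.

(** * Calculus in tensor products *)

Section TensorInd.
Variables (R : pzRingType) (M : lmodType R^c) (F : lmodType R).

Lemma tensDl m m' (x : F) : tens (m + m' : M) x = tens m x + tens m' x.
Proof. by case: (tens_balanced M F) => h _ _; exact: h. Qed.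

Lemma tensDr (m : M) (x x' : F) : tens m (x + x') = tens m x + tens m x'.
Proof. by case: (tens_balanced M F) => _ h _; exact: h. Qed.

Lemma tensZ (m : M) c (x : F) : tens m (c *: x) = tens ((c : R^c) *: m) x.
Proof. by case: (tens_balanced M F) => _ _ ->. Qed.

Lemma tens0l (x : F) : tens (0 : M) x = 0.
Proof. by apply/(addIr (tens 0 x)); rewrite -tensDl !add0r. Qed.

Lemma tens0r (m : M) : tens m (0 : F) = 0.
Proof. by apply/(addIr (tens m 0)); rewrite -tensDr !add0r. Qed.

Lemma tensBl m m' (x : F) : tens (m - m' : M) x = tens m x - tens m' x.
Proof. by apply/(addIr (tens m' x)); rewrite -tensDl !subrK. Qed.

(** A representative of [t] is a finite integral combination of words, and words map to pure
    tensors. *)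
Lemma tensor_ind (S : {pred tensor M F}) : zmod_closed S ->
  (forall m x, tens m x \in S) -> forall t, t \in S.
Proof.
move=> Sclosed St t.
pose S' : zmodClosed (tensor M F) :=
  HB.pack S (GRing.isZmodClosed.Build (tensor M F) S Sclosed).
rewrite -[S]/(S' : {pred _}) -[t]reprK -[repr t]freeg_sumE raddf_sum.
apply: rpred_sum => mx _; rewrite -[coeff _ _]intz -freegU_mulz raddfMz.
apply: rpredMz.
by case: mx => m x; exact: St.
Qed.

Lemma tensor_mapD (N : lmodType R^c) (f : {linear M -> N}) :
  {morph tensor_map (F := F) f : t u / t + u}.
Proof.
have map0 : tensor_map (F := F) f 0 = 0.
  by rewrite -(subrr 0) tensor_mapB subrr.
by move=> t u; rewrite -{1}[u]opprK -[- u]sub0r !tensor_mapB map0 sub0r opprK.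
Qed.

End TensorInd.

(** * The cokernel of the directed system, its flatness, and the resulting cone *)

Section DirectedSystem.
Variables (R : pzRingType) (I : choiceType) (le : I -> I -> Prop).
Variables (a b : I -> R) (r s : I -> I -> R) (i0 : I).
Hypothesis le_trans : forall i j k, le i j -> le j k -> le i k.
Hypothesis le_directed : forall i j, exists2 k, le i k & le j k.
Hypothesis coprime : forall i, exists x y, a i * x + b i * y = 1.
Hypothesis ar : forall i j, le i j -> a j = a i * r i j.
Hypothesis bs : forall i j, le i j -> b j = b i * s i j.
Hypothesis rr : forall i j k, le i j -> le j k -> r i k = r i j * r j k.
Hypothesis ss : forall i j k, le i j -> le j k -> s i k = s i j * s j k.

Definition eventually (Q : I -> Prop) := exists j, forall k, le j k -> Q k.

Lemma eventuallyT (Q : I -> Prop) : (forall k, Q k) -> eventually Q.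
Proof. by exists i0. Qed.

Lemma eventuallyI (Q1 Q2 : I -> Prop) : eventually Q1 -> eventually Q2 ->
  eventually (fun k => Q1 k /\ Q2 k).
Proof.
move=> [j1 h1] [j2 h2]; have [j l1 l2] := le_directed j1 j2.
by exists j => k jk; split; [apply: h1|apply: h2]; exact: le_trans jk.
Qed.

Lemma eventually_ge i : eventually (le i).
Proof. by exists i. Qed.

Lemma eventuallyW (Q1 Q2 : I -> Prop) : (forall k, Q1 k -> Q2 k) ->
  eventually Q1 -> eventually Q2.
Proof. by move=> h [j hj]; exists j => k /hj; exact: h. Qed.

Lemma eventually_ex Q : eventually Q -> exists k, Q k.
Proof.
by move=> [j hj]; have [k jk _] := le_directed j j; exists k; exact: hj.
Qed.

Local Notation P0 := (freemod R (I + I)%type).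
Local Notation e i := (free_delta R (inl i : I + I)%type).
Local Notation f i := (free_delta R (inr i : I + I)%type).

(* [(coordl k p, coordr k p)] is the image of [p] in the [k]-th copy of
   [R * R]; it is meaningless unless [k] bounds the indices occurring in [p]. *)
Definition coordl k : {linear P0 -> R^o} :=
  free_lift ((fun x => if x is inl i then r i k else 0) : I + I -> R^o).
Definition coordr k : {linear P0 -> R^o} :=
  free_lift ((fun x => if x is inr i then s i k else 0) : I + I -> R^o).

Lemma coordl_e k i : coordl k (e i) = r i k. Proof. exact: free_lift_delta. Qed.
Lemma coordl_f k i : coordl k (f i) = 0. Proof. exact: free_lift_delta. Qed.
Lemma coordr_e k i : coordr k (e i) = 0. Proof. exact: free_lift_delta. Qed.
Lemma coordr_f k i : coordr k (f i) = s i k. Proof. exact: free_lift_delta. Qed.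

(** Says that [p] dies in the cokernel and records [z], its preimage in the limit of the copies of
    [R]. *)
Definition null_at (p : P0) (z : R) :=
  eventually (fun k => coordl k p = z * a k /\ coordr k p = z * b k).

Lemma null_atP c p q z w : null_at p z -> null_at q w ->
  null_at (c *: p + q) (c * z + w).
Proof.
move=> hp hq; apply: eventuallyW (eventuallyI hp hq) => k [[p1 p2] [q1 q2]].
by rewrite !linearP p1 p2 q1 q2 !mulrDl -!mulrA.
Qed.

Lemma null_at0 : null_at 0 0.
Proof. by apply: eventuallyT => k; rewrite !linear0 !mul0r. Qed.

(** A relation [a k * x + b k * y = 1] yields the retraction [(u, v) |-> u * x + v * y] of the
    [k]-th map, which recovers the preimage. *)
Lemma null_at_inj p z w : null_at p z -> null_at p w -> z = w.
Proof.
move=> hz hw; have [k [[z1 z2] [w1 w2]]] := eventually_ex (eventuallyI hz hw).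
have [x [y xy]] := coprime k.
by rewrite -[z]mulr1 -[w]mulr1 -xy !mulrDr !mulrA -z1 -z2 -w1 -w2.
Qed.

Lemma null_at_e i j : le i j -> null_at (- r i j *: e j + e i) 0.
Proof.
move=> ij; apply: eventuallyW (eventually_ge j) => k jk.
rewrite !linearP !coordl_e !coordr_e (rr ij jk) !mul0r scaler0 addr0.
by rewrite [- _ *: _]mulNr addNr.
Qed.

Lemma null_at_f i j : le i j -> null_at (- s i j *: f j + f i) 0.
Proof.
move=> ij; apply: eventuallyW (eventually_ge j) => k jk.
rewrite !linearP !coordl_f !coordr_f (ss ij jk) !mul0r scaler0 addr0.
by rewrite [- _ *: _]mulNr addNr.
Qed.

Lemma null_at_ef i : null_at (a i *: e i + b i *: f i) 1.
Proof.
apply: eventuallyW (eventually_ge i) => k ik.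
rewrite !linearP !linearZ coordl_e coordr_e coordl_f coordr_f !mul1r.
by rewrite /= !scaler0 addr0 add0r (ar ik) (bs ik).
Qed.

Definition null : {pred P0} := fun p => `[< exists z, null_at p z >].

Lemma null_submod_closed : submod_closed null.
Proof.
split=> [|c p q /asboolP[z hz] /asboolP[w hw]]; apply/asboolP.
  by exists 0; exact: null_at0.
by exists (c * z + w); exact: null_atP.
Qed.

(* the cokernel of the direct limit of the split monomorphisms
   [z |-> (z * a i, z * b i)] *)
Definition limcoker : lmodType R := lmod_quot null_submod_closed.
Local Notation C := limcoker.
Local Notation pi := (lmod_pi null_submod_closed).
Local Notation rep := (@lmod_repr _ _ _ null_submod_closed).

Lemma pi_null p z : null_at p z -> pi p = 0.
Proof. by move=> h; apply/lmod_pi_eq0/asboolP; exists z. Qed.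

Lemma rep_pi p : exists z, null_at (rep (pi p) - p) z.
Proof. by apply/asboolP; apply/(lmod_pi_eq null_submod_closed)/lmod_reprK. Qed.

Lemma pi_eq0 p : pi p = 0 -> exists z, null_at p z.
Proof. by move=> /lmod_pi_eq0/asboolP. Qed.

Lemma pi_e i j : le i j -> pi (e i) = r i j *: pi (e j).
Proof.
move=> /null_at_e/pi_null; rewrite linearD linearZ /= scaleNr addrC.
exact: subr0_eq.
Qed.

Lemma pi_f i j : le i j -> pi (f i) = s i j *: pi (f j).
Proof.
move=> /null_at_f/pi_null; rewrite linearD linearZ /= scaleNr addrC.
exact: subr0_eq.
Qed.

Lemma pi_ef i : a i *: pi (e i) + b i *: pi (f i) = 0.
Proof. by have /pi_null := null_at_ef i; rewrite linearD !linearZ. Qed.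

(** By directedness, combinations living at stages [i] and [j] can be rewritten at a common later
    stage. *)
Lemma limcoker_gen (x : C) : exists i c d, x = c *: pi (e i) + d *: pi (f i).
Proof.
rewrite -[x]lmod_reprK.
suff /asboolP : rep x \in
  [pred p | `[< exists i c d, pi p = c *: pi (e i) + d *: pi (f i) >]] by [].
apply: free_ind => [|[i|i]].
- split=> [|c p q /asboolP[i [ci [di hi]]] /asboolP[j [cj [dj hj]]]].
    by apply/asboolP; exists i0, 0, 0; rewrite !scale0r addr0 linear0.
  have [k ik jk] := le_directed i j; apply/asboolP.
  exists k, (c * ci * r i k + cj * r j k), (c * di * s i k + dj * s j k).
  rewrite [pi _]linearP /= hi hj (pi_e ik) (pi_e jk) (pi_f ik) (pi_f jk).
  by rewrite scalerDr !scalerA addrACA !scalerDl !mulrA.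
- by apply/asboolP; exists i, 1, 0; rewrite scale1r scale0r addr0.
- by apply/asboolP; exists i, 0, 1; rewrite scale1r scale0r add0r.
Qed.

Local Notation act n c := ((c : R^c) *: n).

Section Tensor.
Variable N : lmodType R^c.
Implicit Types n m w : N.

Lemma actA n (c d : R) : act (act n c) d = act n (c * d).
Proof. by rewrite scalerA. Qed.

Lemma null_at_act n p z : null_at p z -> eventually (fun k =>
  act n (coordl k p : R) = act (act n z) (a k) /\
  act n (coordr k p : R) = act (act n z) (b k)).
Proof. by apply: eventuallyW => k [-> ->]; rewrite !actA. Qed.

Lemma tensor_limcokerE (t : tensor N C) :
  exists i n m, t = tens n (pi (e i)) + tens m (pi (f i)).
Proof.
suff /asboolP : t \in [pred t : tensor N C |
  `[< exists i n m, t = tens n (pi (e i)) + tens m (pi (f i)) >]] by [].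
apply: tensor_ind t => [|n x].
  split=> [|t u /asboolP[i [ni [mi ->]]] /asboolP[j [nj [mj ->]]]];
    apply/asboolP.
    by exists i0, 0, 0; rewrite !tens0l addr0.
  have [k ik jk] := le_directed i j.
  exists k, (act ni (r i k) - act nj (r j k)),
    (act mi (s i k) - act mj (s j k)).
  rewrite (pi_e ik) (pi_e jk) (pi_f ik) (pi_f jk) !tensBl !tensZ.
  by rewrite opprD addrACA.
apply/asboolP; have [i [c [d ->]]] := limcoker_gen x.
by exists i, (act n c), (act n d); rewrite tensDr !tensZ.
Qed.

(** First coordinate of a word at stage [k], read off chosen representatives in [P0]. As [rep] need
    not be linear, the tensor relators need not go to zero; [word_null] describes the defect. *)
Definition evall k (z : {freeg (N * C)%type / int}) : N :=
  word_lift (fun n x => act n (coordl k (rep x) : R)) z.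
Definition evalr k (z : {freeg (N * C)%type / int}) : N :=
  word_lift (fun n x => act n (coordr k (rep x) : R)) z.

Definition word_null z : Prop := exists w, eventually (fun k =>
  evall k z = act w (a k) /\ evalr k z = act w (b k)).

(** Additivity in the first factor holds exactly, with [w = 0]. In the other two relators the
    representatives differ by some [p] with [null_at p d], which gives [w = act n d]. *)
Lemma tensor_null_word_null z : z \in @tensor_null R N C -> word_null z.
Proof.
move=> /tensor_nullP hz; apply/asboolP.
apply: (hz [pred z | `[< word_null z >]]) => [|y].
  split=> [|y t /asboolP[v hv] /asboolP[w hw]]; apply/asboolP.
    exists 0; apply: eventuallyT => k.
    by rewrite !scaler0 -(subrr 0) /evall /evalr !word_liftB !subrr.
  exists (v - w); apply: eventuallyW (eventuallyI hv hw) => k [[v1 v2] [w1 w2]].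
  by rewrite /evall /evalr !word_liftB -/(evall _ _) -/(evalr _ _) !scalerBr
    -v1 -v2 -w1 -w2.
move=> yrel; apply/asboolP.
case: yrel => -[].
- move=> n [m [x ->]]; exists 0; apply: eventuallyT => k.
  rewrite /evall /evalr !word_liftB !word_liftE !scaler0 !scalerDr.
  by rewrite ![_ + _ *: m]addrC !addrK !subrr.
- move=> n [x [x' ->]]; pose p := rep (x + x') - rep x - rep x'.
  have [|d /(null_at_act n)] := @pi_eq0 p.
    by rewrite !linearB /= !lmod_reprK addrAC addrK subrr.
  move=> hd; exists (act n d); apply: eventuallyW hd => k [<- <-].
  rewrite /evall /evalr !word_liftB !word_liftE.
  have pB (g : {linear P0 -> R^o}) :
    g p = (g (rep (x + x')) - g (rep x) - g (rep x') : R) by rewrite !linearB.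
  by rewrite !pB !(scalerBl (R := R^c)).
- move=> n [c [x ->]]; pose p := c *: rep x - rep (c *: x).
  have [|d /(null_at_act n)] := @pi_eq0 p.
    by rewrite linearB linearZ /= !lmod_reprK subrr.
  move=> hd; exists (act n d); apply: eventuallyW hd => k [<- <-].
  rewrite /evall /evalr !word_liftB !word_liftE.
  have pB (g : {linear P0 -> R^o}) :
    g p = (c * g (rep x) - g (rep (c *: x)) : R) by rewrite linearB linearZ.
  by rewrite !pB !(scalerBl (R := R^c)) !actA.
Qed.

(** Exactness after tensoring with [N], made explicit: moved to late stages, the pair [(n, m)] comes
    from a single element of [N]. *)
Lemma tens_limcoker_eq0 i n m :
  tens n (pi (e i)) + tens m (pi (f i)) = 0 ->
  exists w, eventually (fun k => act n (r i k) = act w (a k) /\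
                                 act m (s i k) = act w (b k)).
Proof.
move=> /(canRL (addrK _)).
(* The second tensor is moved across as [tens (- m) (pi (f i))], so that the equation compares the
   classes of two words. *)
rewrite -[in X in X - _](tens0l _ (pi (f i))) -tensBl sub0r => /eqP.
rewrite -Quotient.idealrBE.
move=> /tensor_null_word_null[w hw].
have [c hc] := rep_pi (e i); have [d hd] := rep_pi (f i).
(* The two subtracted terms correct for evaluating at [rep (pi (e i))] and [rep (pi (f i))] instead
   of [e i] and [f i]. *)
exists (w - act n c - act m d).
have := eventuallyI hw (eventuallyI (null_at_act n hc) (null_at_act m hd)).
apply: eventuallyW => k [[w1 w2] [[c1 c2] [d1 d2]]].
have actB n' (x y : R) : act n' (x - y) = act n' x - act n' y.
  exact: (scalerBl (R := R^c)).
rewrite !scalerBr -w1 -w2 -c1 -c2 -d1 -d2 /evall /evalr !word_liftB !word_liftE.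
have pB (g : {linear P0 -> R^o}) p q : g (p - q) = (g p - g q : R).
  by rewrite linearB.
rewrite !pB !actB coordl_e coordl_f coordr_e coordr_f.
rewrite !(scale0r (R := R^c)) !subr0.
rewrite !scalerN !opprK; split; first by rewrite addrAC addrK subKr.
by rewrite (addrC (act n _)) addrK subKr.
Qed.

End Tensor.

(** If the image of a tensor vanishes, its late coordinates come from some [w] in [N]. The splitting
    shows that [w] already comes from [M], so the tensor is a multiple of the relation [pi_ef] and
    vanishes. *)
Lemma limcoker_flat : flat C.
Proof.
move=> M N h hinj.
suff ker0 t : tensor_map (F := C) h t = 0 -> t = 0.
  by move=> t u tu; apply/subr0_eq/ker0; rewrite tensor_mapB tu subrr.
have [i [n [m ->]]] := tensor_limcokerE t.
rewrite tensor_mapD !tensor_mapE => /tens_limcoker_eq0[w hw].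
have [k [[wr ws] ik]] := eventually_ex (eventuallyI hw (eventually_ge i)).
have [x [y xy]] := coprime k.
(* The retraction at stage [k] applied to the coordinates in [M]; [h] carries it to [w]. *)
pose v := act n (r i k * x) + act m (s i k * y).
have hv : h v = w.
  rewrite linearD !linearZ /= -!actA wr ws !actA -(scalerDl (R := R^c)).
  by rewrite [_ + _](xy : _ = 1 :> R^c) scale1r.
have nv : act n (r i k) = act v (a k) by apply: hinj; rewrite !linearZ /= hv.
have mv : act m (s i k) = act v (b k) by apply: hinj; rewrite !linearZ /= hv.
rewrite (pi_e ik) (pi_f ik) !tensZ nv mv -!tensZ -tensDr pi_ef.
exact: tens0r.
Qed.

Lemma compatible_cone : left_cotorsion R -> exists rho sigma : I -> R,
  [/\ forall i j, le i j -> rho i = r i j * rho j,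
      forall i j, le i j -> sigma i = s i j * sigma j &
      forall i, a i * rho i + b i * sigma i = 1].
Proof.
move=> /(_ C limcoker_flat) ext0.
(* The preimage of [p], unique by [null_at_inj]; the default 0 is taken only outside the kernel of
   [pi], where [ext_extend] asks nothing. *)
pose z p : R := xget 0 (null_at p).
have zE p c : null_at p c -> z p = c.
  move=> h; apply: (null_at_inj _ h).
  by rewrite /z; case: xgetP => [_ ->|/(_ c)].
have [|c p q /pi_eq0[u pu] /pi_eq0[v qv]|g gE] :=
  @ext_extend _ _ _ pi (@free_projective R _) _ R^o (z : P0 -> R^o) ext0.
- by move=> x; exists (rep x); exact: lmod_reprK.
- by rewrite (zE _ _ (null_atP c pu qv)) (zE _ _ pu) (zE _ _ qv).
have gz p c : null_at p c -> g p = c.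
  by move=> h; rewrite gE ?(zE _ _ h) //; exact: pi_null h.
exists (fun i => g (e i)), (fun i => g (f i)); split=> [i j ij|i j ij|i].
- have := gz _ _ (null_at_e ij); rewrite linearP => /eqP /=.
  by rewrite [- _ *: _]mulNr addrC subr_eq0 => /eqP.
- have := gz _ _ (null_at_f ij); rewrite linearP => /eqP /=.
  by rewrite [- _ *: _]mulNr addrC subr_eq0 => /eqP.
- by have := gz _ _ (null_at_ef i); rewrite linearP linearZ.
Qed.

End DirectedSystem.

(** * Coprime pairs as elements of the product ring, and maximal compatible chains *)

Section CoprimePairs.
Variable R : pzRingType.
Local Notation T := (R * R)%type.
Implicit Types p q m : T.

Definition coprime_gen p := exists x y, p.1 * x + p.2 * y = 1.

Lemma right_coprimeP p : right_coprime p <-> coprime_gen p.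
Proof.
rewrite /right_coprime; split=> [pT|[x [y xy]]].
  have : [set: R] 1 by [].
  by rewrite -pT => -[_ [x _ <-] [_ [y _ <-] xy]]; exists x, y.
apply/seteqP; split=> // z _; exists (p.1 * (x * z)); first by exists (x * z).
exists (p.2 * (y * z)); first by exists (y * z).
by rewrite !mulrA -mulrDl xy mul1r.
Qed.

Lemma right_ideal_sub (a b : R) :
  right_ideal b `<=` right_ideal a <-> exists r, b = a * r.
Proof.
split=> [ba|[r ->] _ [x _ <-]]; last by exists (r * x); rewrite ?mulrA.
have [|r _ <-] := ba b; first by exists 1; rewrite ?mulr1.
by exists r.
Qed.

Lemma coprime_pair_leP (P Q : coprime_pair R) :
  coprime_pair_le P Q <-> exists m : T, (P : T) = (Q : T) * m.
Proof.
split=> [/asboolP[/right_ideal_sub[r e1] /right_ideal_sub[s e2]]|[m e]].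
  by exists (r, s); rewrite [LHS]surjective_pairing e1 e2.
by apply/asboolP; rewrite e; split; apply/right_ideal_sub;
  [exists m.1 | exists m.2].
Qed.

Section Cone.
Hypothesis Rcot : left_cotorsion R.

Lemma directed_cone (I : choiceType) (le : I -> I -> Prop)
    (ab : I -> T) (rs : I -> I -> T) (i0 : I) :
  (forall i j k, le i j -> le j k -> le i k) ->
  (forall i j, exists2 k, le i k & le j k) ->
  (forall i, coprime_gen (ab i)) ->
  (forall i j, le i j -> ab j = ab i * rs i j) ->
  (forall i j k, le i j -> le j k -> rs i k = rs i j * rs j k) ->
  exists (q : T) (mu : I -> T), [/\ coprime_gen q,
    forall i, q = ab i * mu i & forall i j, le i j -> mu i = rs i j * mu j].
Proof.
move=> le_trans le_dir cop abE rsE.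
have [||||rho [sigma [rhoE sigmaE one]]] := @compatible_cone R I le
  (fun i => (ab i).1) (fun i => (ab i).2)
  (fun i j => (rs i j).1) (fun i j => (rs i j).2)
  i0 le_trans le_dir cop _ _ _ _ Rcot.
- by move=> i j /abE ->.
- by move=> i j /abE ->.
- by move=> i j k ij jk; rewrite (rsE _ _ _ ij jk).
- by move=> i j k ij jk; rewrite (rsE _ _ _ ij jk).
pose mu i : T := (rho i, sigma i).
have muE i j : le i j -> mu i = rs i j * mu j.
  by move=> ij; rewrite /mu (rhoE _ _ ij) (sigmaE _ _ ij).
exists (ab i0 * mu i0), mu; split=> // [|i].
  by exists 1, 1; rewrite !mulr1 one.
(* The product [ab i * mu i] does not depend on [i]: at a common bound [k] it equals
   [ab k * mu k]. *)
have [k ik jk] := le_dir i0 i.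
by rewrite (muE _ _ ik) (muE _ _ jk) !mulrA -!abE.
Qed.

(* [G (p, q, m)] stands for a transition [q = p * m] of a compatible chain, and
   [G (p, p, 1)] for the membership of [p] in the chain. *)
Definition chain_graph (base : T) (G : set (T * T * T)) :=
  [/\ forall p q m, G (p, q, m) -> [/\ q = p * m, G (p, p, 1) & G (q, q, 1)],
      forall p q m m', G (p, q, m) -> G (p, q, m') -> m = m',
      forall p q k m m', G (p, k, m) -> G (k, q, m') -> G (p, q, m * m'),
      forall p q, G (p, p, 1) -> G (q, q, 1) ->
        exists m, G (p, q, m) \/ G (q, p, m) &
      forall p, G (p, p, 1) -> coprime_gen p /\ exists m, p = base * m].

(** Each condition involves at most two given triples, and these lie in a common member of the
    family. *)
Lemma chain_graph_bigcup base (F : set (set (T * T * T))) :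
  F `<=` chain_graph base -> total_on F subset ->
  chain_graph base (\bigcup_(G in F) G).
Proof.
move=> FP Ftot.
have join G G' x y : F G -> G x -> F G' -> G' y ->
    exists H, [/\ F H, chain_graph base H, H x & H y].
  move=> FG Gx FG' G'y; have [GG'|G'G] := Ftot _ _ FG FG'.
    by exists G'; split=> //; [exact: FP|exact: GG'].
  by exists G; split=> //; [exact: FP|exact: G'G].
split=> [p q m [G FG Gx]|p q m m' [G FG Gx] [G' FG' Gy]
  |p q k m m' [G FG Gx] [G' FG' Gy]|p q [G FG Gx] [G' FG' Gy]|p [G FG Gx]].
- have [/(_ _ _ _ Gx)[qE Gp Gq] _ _ _ _] := FP _ FG.
  by split=> //; exists G.
- have [H [_ [_ h _ _ _] Hx Hy]] := join _ _ _ _ FG Gx FG' Gy.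
  exact: h Hx Hy.
- have [H [FH [_ _ h _ _] Hx Hy]] := join _ _ _ _ FG Gx FG' Gy.
  by exists H => //; exact: h Hx Hy.
- have [H [FH [_ _ _ h _] Hx Hy]] := join _ _ _ _ FG Gx FG' Gy.
  by have [m [h1|h1]] := h _ _ Hx Hy; exists m; [left|right]; exists H.
- by have [_ _ _ _ h] := FP _ FG; exact: h Gx.
Qed.

Lemma chain_graph_cone base G : coprime_gen base -> chain_graph base G ->
  exists (q : T) (mu : T -> T), [/\ coprime_gen q, exists m, q = base * m,
    forall p, G (p, p, 1) -> q = p * mu p &
    forall p p' m, G (p, p', m) -> mu p = m * mu p'].
Proof.
move=> basecop [GE Gfun Gtrans Gtot Gcop].
have [[p0 Gp0]|G0] := pselect (exists p, G (p, p, 1)); last first.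
  (* For the empty chain [base] itself is the bound. *)
  exists base, id; split=> // [|p Gp|p p' m /GE[_ Gp _]].
  - by exists 1; rewrite mulr1.
  - by case: G0; exists p.
  - by case: G0; exists p.
pose D : pred T := fun p => `[< G (p, p, 1) >].
pose I := {p : T | D p}.
have GI (i : I) : G (val i, val i, 1) by apply/asboolP; case: i.
pose le (i j : I) := exists m, G (val i, val j, m).
(* [Gfun] makes the transition unique when there is one; otherwise the default 0 is never
   consulted. *)
pose rs (i j : I) := xget 0 [set m | G (val i, val j, m)].
have rsP i j m : G (val i, val j, m) -> rs i j = m.
  move=> h; apply: (Gfun _ _ _ _ _ h).
  by rewrite /rs; case: xgetP => [_ -> //|/(_ m h)].
have p0I : D p0 by apply/asboolP.
have [|||||q [mu [qcop qE muE]]] := @directed_cone I le val rs (Sub p0 p0I).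
- by move=> i j k [m h] [m' h']; exists (m * m'); exact: Gtrans h h'.
- move=> i j; have [m [h|h]] := Gtot _ _ (GI i) (GI j).
    by exists j; [exists m|exists 1; exact: GI].
  by exists i; [exists 1; exact: GI|exists m].
- by move=> i; case: (Gcop _ (GI i)).
- by move=> i j [m h]; rewrite (rsP _ _ _ h); case: (GE _ _ _ h).
- move=> i j k [m h] [m' h'].
  by rewrite (rsP _ _ _ h) (rsP _ _ _ h'); exact/rsP/Gtrans/h'.
exists q, (fun p => if insub p is Some i then mu i else 0); split=> //.
- have [_ [m p0E]] := Gcop _ Gp0; exists (m * mu (Sub p0 p0I)).
  by have := qE (Sub p0 p0I); rewrite SubK mulrA -p0E.
- move=> p /asboolP Gp; rewrite (insubT D Gp).
  by have := qE (Sub p Gp); rewrite SubK.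
- move=> p p' m Gm; have [_ /asboolP Gp /asboolP Gp'] := GE _ _ _ Gm.
  rewrite (insubT D Gp) (insubT D Gp') -(rsP (Sub p Gp) (Sub p' Gp') m) //.
  by apply: muE; exists m.
Qed.

(** Take the cone [q] of a maximal chain below [base]. A pair [q'] below [q] but not equivalent to
    it could be appended to the chain, against maximality. *)
Lemma minimal_below base : coprime_gen base ->
  exists q, [/\ coprime_gen q, exists m, q = base * m &
    forall q' m, coprime_gen q' -> q' = q * m -> exists m', q = q' * m'].
Proof.
move=> basecop.
have [G [Gchain Gmax]] := Zorn_bigcup (@chain_graph_bigcup base).
have [q [mu [qcop [mq qbase] qE muE]]] := chain_graph_cone basecop Gchain.
have [GE Gfun Gtrans Gtot Gcop] := Gchain.
exists q; split=> [//||q' m0 q'cop q'E]; first by exists mq.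
apply: contrapT => q'lt.
have Gq' : ~ G (q', q', 1) by move=> /qE qq'; apply: q'lt; exists (mu q').
(* The transition from [p] to [q'] goes through [q]: first [mu p], then [m0]. *)
pose G' : set (T * T * T) := G `|` [set x | x = (q', q', 1) \/
  exists2 p, G (p, p, 1) & x = (p, q', mu p * m0)].
have G'cop : G' (q', q', 1) by right; left.
have newl m p : ~ G (q', p, m) by case/GE.
have newr m p : ~ G (p, q', m) by case/GE.
apply: (Gmax G'); first split.
- by move=> x Gx; left.
- by move=> /(_ _ G'cop).
split.
- move=> p k m [/GE[kE Gp Gk]|[[-> -> ->]|[p' Gp' [-> -> ->]]]].
  + by split=> //; left.
  + by split=> //; rewrite mulr1.
  + by split=> //; [rewrite mulrA -qE|left].
- move=> p k m m' [Gm|[[-> -> ->]|[p' Gp' [-> -> ->]]]].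
  + move=> [Gm'|[[? e _]|[p'' _ [_ e _]]]]; first exact: Gfun Gm Gm'.
      by rewrite e in Gm; case: (newr _ _ Gm).
    by rewrite e in Gm; case: (newr _ _ Gm).
  + move=> [/newl//|[[->//]|[p'' Gp'' [e _]]]].
    by case: Gq'; rewrite e.
  + move=> [/newr//|[[e _]|[p'' _ [-> ->]//]]].
    by case: Gq'; rewrite -e.
- move=> p k l m m' [Gm|[[-> -> ->]|[p' Gp' [-> -> ->]]]].
  + move=> [Gm'|[[e _ _]|[p'' Gp'' [e -> ->]]]].
    * by left; exact: Gtrans Gm Gm'.
    * by rewrite e in Gm; case: (newr _ _ Gm).
    (* The compatibility [muE] of the cone with transitions makes the composite into [q'] the
       prescribed one. *)
    * right; right; exists p; first by case: (GE _ _ _ Gm).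
      by rewrite mulrA -e -(muE _ _ _ Gm).
  + move=> [/newl//|[[-> ->]|[p'' Gp'' [e _ _]]]]; first by rewrite mulr1.
    by case: Gq'; rewrite e.
  + move=> [/newl//|[[-> ->]|[p'' Gp'' [e _ _]]]].
      by rewrite mulr1; right; right; exists p'.
    by case: Gq'; rewrite e.
- have G'D p : G' (p, p, 1) -> G (p, p, 1) \/ p = q'.
    by move=> [|[[->]|[p' Gp' [-> -> _]]]]; [left|right|right].
  move=> p k /G'D[Gp|->] /G'D[Gk|->].
  + by have [m [h|h]] := Gtot _ _ Gp Gk; exists m; [left|right]; left.
  + by exists (mu p * m0); left; right; right; exists p.
  + by exists (mu k * m0); right; right; right; exists k.
  + by exists 1; left.
- move=> p [/Gcop//|[[-> _]|[p' _ [-> -> _]]]].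
    by split=> //; exists (mq * m0); rewrite mulrA -qbase.
  by split=> //; exists (mq * m0); rewrite mulrA -qbase.
Qed.

End Cone.
End CoprimePairs.

(** * Minimal lower bounds of compatible chains *)

Theorem theorem3p6 (R : pzRingType) :
  left_cotorsion R -> right_strongly_exchange R.
Proof.
move=> Rcot d I _ P [_ [a [b [r [s [gens trans comp]]]]]].
pose ab i := (a i, b i).
have cop i : coprime_gen (ab i).
  have [p [pE _]] := gens i; rewrite -[ab i]pE.
  exact/right_coprimeP/asboolP/coprime_pairP.
have [q0 [q0cop q0E]] : exists q0 : R * R, coprime_gen q0 /\
    forall i, exists m : R * R, q0 = ab i * m.
  have [[i0 _]|noI] := pselect (exists i : I, True); last first.
    (* Every coprime pair bounds the empty chain. *)
    exists (1, 0); split=> [|i]; last by case: noI; exists i.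
    by exists 1, 0; rewrite mulr1 mulr0 addr0.
  (* The chain prescribes transitions only for [i < j]; the value 1 on the diagonal extends them to
     the reflexive order. *)
  pose rs i j : R * R := if i == j then 1 else (r i j, s i j).
  have [|||||q0 [mu [q0cop q0E _]]] :=
    @directed_cone R Rcot I (fun i j => (i <= j)%O) ab rs i0.
  - by move=> i j k; exact: le_trans.
  - move=> i j; have [ij|/ltW ji] := leP i j; first by exists j.
    by exists i.
  - exact: cop.
  - move=> i j; rewrite le_eqVlt /rs; case: eqVneq => [->|_ /= /trans[e1 e2]].
      by rewrite mulr1.
    by rewrite /ab e1 e2.
  - move=> i j k; rewrite !le_eqVlt /rs.
    case: (eqVneq i j) => [-> _|_ /= ij]; first by rewrite mul1r.
    case: (eqVneq j k) => [<- _|_ /= jk]; first by rewrite mulr1 lt_eqF.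
    by rewrite (lt_eqF (lt_trans ij jk)); have [-> ->] := comp _ _ _ ij jk.
  by exists q0; split=> // i; exists (mu i).
have [q [qcop [m0 qE] qmin]] := minimal_below Rcot q0cop.
have qP : `[< right_coprime q >] by apply/asboolP/right_coprimeP.
pose Q := CoprimePair qP.
exists (\pi_(RCP R) Q); split=> [i|X].
  have [p [pE <-]] := gens i; have [m q0m] := q0E i.
  suff : coprime_pair_le Q p by rewrite -RCP_le_pi.
  by apply/coprime_pair_leP; exists (m * m0); rewrite pE mulrA -q0m.
rewrite -[X]reprK => XQ.
have {XQ} : coprime_pair_le (repr X) Q by rewrite -RCP_le_pi.
move=> /coprime_pair_leP[m XE].
suff : coprime_pair_le Q (repr X) by rewrite -RCP_le_pi.
apply/coprime_pair_leP; apply: qmin XE.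
exact/right_coprimeP/asboolP/coprime_pairP.
Qed.
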